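(* Assume that $T^\#T$ and $V^\#V$ are indefinite operators on $\mathcal{H}$ such that $N(T)\cap N(V)=\{0\}$. Assume that $\mathcal{Z}(w,z)\neq\varnothing$ for every $(w,z)\in\mathcal{K}\times\mathcal{E}$. Then there exists $\alpha>0$ such that $[Ty,Ty]_{\mathcal{K}}\geq\alpha\|y\|^2$ for every $y\in\mathcal{C}_V$.
   Context: $(\mathcal{H},\langle\cdot,\cdot\rangle)$ is a complex separable Hilbert space, $(\mathcal{K},[\cdot,\cdot]_{\mathcal{K}})$ and $(\mathcal{E},[\cdot,\cdot]_{\mathcal{E}})$ are complex Krein spaces (boundedness of operators and topologies refer to the norm of any associated Hilbert space). $T:\mathcal{H}\to\mathcal{K}$ is a bounded linear operator with closed range and $V:\mathcal{H}\to\mathcal{E}$ is a bounded linear surjective operator; $N(\cdot)$ denotes the nullspace. $T^\#:\mathcal{K}\to\mathcal{H}$ and $V^\#:\mathcal{E}\to\mathcal{H}$ denote the adjoints, determined by $[Tx,w]_{\mathcal{K}}=\langle x,T^\#w\rangle$ and $[Vx,z]_{\mathcal{E}}=\langle x,V^\#z\rangle$ for all $x\in\mathcal H$, $w\in\mathcal K$, $z\in\mathcal E$. A selfadjoint operator on $\mathcal{H}$ is indefinite if it is neither positive nor negative semidefinite. $\mathcal{C}_V=\{y\in\mathcal{H}: [Vy,Vy]_{\mathcal{E}}=0\}$. For $(w,z)\in\mathcal{K}\times\mathcal{E}$, $\mathcal{Z}(w,z)$ is the set of vectors at which the minimum of $[Tx-w,Tx-w]_{\mathcal{K}}$ over $\{x\in\mathcal{H}:[Vx-z,Vx-z]_{\mathcal{E}}=0\}$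 is attained (empty if the minimum does not exist). *)

(* Defs.v *)
From HB Require Import structures.
From mathcomp Require Import all_boot all_order all_algebra.
From mathcomp Require Import all_classical all_reals all_analysis.
From mathcomp Require Import complex.

Set Implicit Arguments.
Unset Strict Implicit.
Unset Printing Implicit Defensive.

Import Order.TTheory GRing.Theory Num.Theory.
Import numFieldNormedType.Exports.

Local Open Scope classical_set_scope.
Local Open Scope complex_scope.
Local Open Scope ring_scope.

(* On R[i], [a <= b] means that [b - a] is a nonnegative real number; values
   [form x x] of hermitian forms are real, so they compare as real numbers. *)

Definition separable (X : topologicalType) : Prop :=
  exists2 D : set X, countable D & dense D.

(* A Hilbert space is a [completeNormedModType] over R[i] whose norm is induced
   by a positive definite hermitian form, linear in the first argument. *)
Definition hilbert_space (R : realType) (H : completeNormedModType R[i])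
    (ip : {dot H for @Num.conj R[i]}) : Prop :=
  forall x : H, `|x| ^+ 2 = ip x x.

Record fundamental_decomposition (R : realType) (K : lmodType R[i])
    (form : {hermitian_sym K for @Num.conj R[i]}) (Kp Km : {pred K}) : Prop := {
  fd_submodp : submod_closed Kp ;
  fd_submodm : submod_closed Km ;
  fd_sum : forall x : K, exists u v : K, [/\ u \in Kp, v \in Km & x = u + v] ;
  fd_ortho : {in Kp & Km, forall u v, form u v = 0} ;
  fd_pos : {in Kp, forall u, u != 0 -> 0 < form u u} ;
  fd_neg : {in Km, forall v, v != 0 -> form v v < 0} }.

(* A Krein space (K, form) is presented with the norm of one of its associated
   Hilbert spaces, i.e. the norm of the inner product
   [u + v, u' + v' |-> form u u' - form v v'] given by some fundamental
   decomposition K = Kp + Km.  As Kp and Km are orthogonal for this inner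
   product, completeness of K (part of [completeNormedModType]) is the
   completeness of both (Kp, form) and (Km, - form). *)
Definition krein_space (R : realType) (K : completeNormedModType R[i])
    (form : {hermitian_sym K for @Num.conj R[i]}) : Prop :=
  exists Kp Km : {pred K}, fundamental_decomposition form Kp Km /\
    {in Kp & Km, forall u v, `|u + v| ^+ 2 = form u u - form v v}.

(* For linear maps the library proves this to be boundedness on a neighbourhood
   of 0 and continuity ([linear_boundedP], [linear_bounded_continuous]). *)
Definition bounded_operator (R : realType) (U W : normedModType R[i])
    (f : U -> W) : Prop :=
  exists M : R, forall x : U, `|f x| <= M%:C * `|x|.

Definition nullspace (R : realType) (U W : lmodType R[i]) (f : U -> W) : set U :=
  f @^-1` [set 0].

Definition adjoint_of (R : realType) (H K : lmodType R[i])
    (ip : {dot H for @Num.conj R[i]})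
    (form : {hermitian_sym K for @Num.conj R[i]})
    (T : H -> K) (Tadj : K -> H) : Prop :=
  forall (x : H) (w : K), form (T x) w = ip x (Tadj w).

Section Operators.
Variables (R : realType) (H : lmodType R[i]) (ip : {dot H for @Num.conj R[i]}).

Definition selfadjoint (A : H -> H) : Prop :=
  forall x y : H, ip (A x) y = ip x (A y).

Definition positive_semidef (A : H -> H) : Prop :=
  forall x : H, 0 <= ip (A x) x.

Definition negative_semidef (A : H -> H) : Prop :=
  forall x : H, ip (A x) x <= 0.

Definition indefinite (A : H -> H) : Prop :=
  [/\ selfadjoint A, ~ positive_semidef A & ~ negative_semidef A].

End Operators.

Section Minimizers.
Variables (R : realType) (H K E : lmodType R[i]).
Variables (formK : {hermitian_sym K for @Num.conj R[i]}).
Variables (formE : {hermitian_sym E for @Num.conj R[i]}).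
Variables (T : H -> K) (V : H -> E).

Definition neutral : set H := [set y | formE (V y) (V y) = 0].

Definition feasible (z : E) : set H := [set x | formE (V x - z) (V x - z) = 0].

Definition minimizers (w : K) (z : E) : set H :=
  [set x | feasible z x /\ forall x', feasible z x' ->
     formK (T x - w) (T x - w) <= formK (T x' - w) (T x' - w)].

End Minimizers.

(* Main.v *)
(* Write P y = [Vy, Vy], Q y = [Ty, Ty] and let C_V be the cone P = 0.
   For z = 0, the objective is bounded below on C_V for every w, i.e. the
   functionals [Ty, .] with y in C_V, Q y <= 1 are pointwise bounded; uniform
   boundedness gives |Ty|^2 <= C Q y on C_V.  The S-lemma then yields a real a
   with Q + a P >= 0 on H, and a <> 0 because Q takes negative values.
   Cauchy-Schwarz for the form of Q + a P, tested on x with Vx = J(Vy), J a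
   fundamental symmetry of E, and |x| <= C |Vy|, gives |Vy|^2 <= C Q y on C_V.
   It remains to compare |y| with |Ty| + |Vy|.  This last norm is complete:
   if T x_n -> w and V x_n -> z, one may correct x_n so that V x_n = z; then the
   objective at (w, z) has infimum 0 and the two estimates force a minimizer y,
   which exists by assumption, to satisfy Ty = w and Vy = z.  Two comparable
   complete norms are equivalent. *)

Require Import Defs.
From HB Require Import structures.
From mathcomp Require Import all_boot all_order all_algebra.
From mathcomp Require Import all_classical all_reals all_analysis.
From mathcomp Require Import complex.
From mathcomp Require Import ring lra.

Set Implicit Arguments.
Unset Strict Implicit.
Unset Printing Implicit Defensive.

Import Order.TTheory GRing.Theory Num.Theory.
Import numFieldNormedType.Exports.

Local Open Scope classical_set_scope.
Local Open Scope complex_scope.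
Local Open Scope ring_scope.

(** * Complete seminorms *)

Section Seminorms.
Variable R : realType.
Implicit Types X : lmodType R[i].

(** Definiteness is left out so that [x |-> NE (V x)] qualifies in [surjection_lift]. *)
Record seminorm X (N : X -> R) : Prop := {
  seminormD : forall x y, N (x + y) <= N x + N y ;
  seminormZ : forall (a : R) x, N (a%:C *: x) = `|a| * N x }.

(** Equivalent to convergence of all Cauchy sequences, since each of them has a subsequence with
    such geometric increments. *)
Definition complete_seminorm X (N : X -> R) : Prop :=
  forall u : nat -> X, (forall i, N (u i.+1 - u i) <= 2^-1 ^+ i) ->
  exists l, forall e, 0 < e -> exists m, forall i, (m <= i)%N -> N (u i - l) <= e.

Lemma expn_half_small (e : R) : 0 < e ->
  exists m, forall i, (m <= i)%N -> 2^-1 ^+ i <= e.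
Proof.
move=> e0; exists (Num.bound e^-1) => i mi; rewrite exprVn invf_ple ?posrE//.
by apply/ltW/upper_nthrootP.
Qed.

(** The restriction e <= 1 lets callers absorb e^2 into e. *)
Lemma le0_eps (x c : R) :
  (forall e, 0 < e -> e <= 1 -> x <= e * c) -> x <= 0.
Proof.
move=> H; rewrite leNgt; apply/negP => x0.
have c0 : 0 <= `|c| by [].
have e0 : 0 < Num.min 1 (x / (2 * (`|c| + 1))).
  by rewrite lt_min ltr01 divr_gt0// mulr_gt0// ltr_wpDl.
have /H := e0; rewrite ge_min lexx => /(_ isT).
set e := Num.min _ _ in e0 *.
have : e <= x / (2 * (`|c| + 1)) by rewrite ge_min lexx orbT.
rewrite ler_pdivlMr; last by rewrite mulr_gt0// ltr_wpDl.
clearbody e => le_ex le_xe.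
have := ler_wpM2l (ltW e0) (ler_norm c); have := mulr_ge0 (ltW e0) c0.
by lra.
Qed.

Section One.
Variables (X : lmodType R[i]) (N : X -> R) (sN : seminorm N).

Lemma seminorm0 : N 0 = 0.
Proof. by rewrite -(scaler0 _ (0%:C)) (seminormZ sN) normr0 mul0r. Qed.

Lemma seminormN x : N (- x) = N x.
Proof.
have := seminormZ sN (-1) x.
by rewrite rmorphN rmorph1 scaleN1r normrN normr1 mul1r.
Qed.

Lemma seminorm_distC x y : N (x - y) = N (y - x).
Proof. by rewrite -seminormN opprB. Qed.

Lemma seminorm_ge0 x : 0 <= N x.
Proof.
have := seminormD sN x (- x); rewrite subrr seminorm0 seminormN; lra.
Qed.

Lemma seminormB x y : N (x - y) <= N x + N y.
Proof. by rewrite -(seminormN y); exact: seminormD. Qed.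

Lemma seminorm_dist z x y : N (x - y) <= N (x - z) + N (z - y).
Proof. by rewrite -(subrKA z); exact: seminormD. Qed.

Lemma geometric_dist (u : nat -> X) :
  (forall i, N (u i.+1 - u i) <= 2^-1 ^+ i) ->
  forall i j, (i <= j)%N -> N (u i - u j) <= 2 * 2^-1 ^+ i.
Proof.
move=> Hu i j ij; rewrite -(subnK ij) addnC; move: (j - i)%N => k {j ij}.
(* Strengthened for the induction: the subtracted term shrinks by exactly the next increment
   2^-(i+k). *)
suff: N (u i - u (i + k)%N) <= 2 * 2^-1 ^+ i - 2 * 2^-1 ^+ (i + k).
  by move=> /le_trans; apply; rewrite lerBlDr lerDl mulr_ge0.
elim: k => [|k IH]; first by rewrite addn0 subrr seminorm0 subrr.
rewrite addnS; apply: le_trans (seminorm_dist (u (i + k)%N) _ _) _.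
have := Hu (i + k)%N; rewrite (seminorm_distC (u _.+1)) exprS.
by move: IH; set P := _ ^+ (i + k); lra.
Qed.

Lemma geometric_limit (cN : complete_seminorm N) (u : nat -> X) :
  (forall i, N (u i.+1 - u i) <= 2^-1 ^+ i) ->
  exists l, forall i, N (u i - l) <= 2 * 2^-1 ^+ i.
Proof.
move=> Hu; have [l Hl] := cN u Hu; exists l => i.
apply/ler_addgt0Pr => e /Hl[m Hm].
apply: le_trans (seminorm_dist (u (maxn m i)) _ _) _.
apply: lerD; first by apply: geometric_dist; rewrite ?leq_maxr.
by apply: Hm; rewrite leq_maxl.
Qed.

(** Baire category: if no [F m] were dense in a ball, every ball would contain a smaller one missing
    [F m], and the centres of nested balls would converge to a point outside all [F m]. The sets are
    not assumed closed, hence density in the conclusion. *)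
Lemma seminorm_baire (cN : complete_seminorm N) (F : nat -> X -> Prop) :
  (forall x, exists m, F m x) ->
  exists m x0 r, 0 < r /\ forall x, N (x - x0) <= r ->
    forall e, 0 < e -> exists2 x', F m x' & N (x - x') <= e.
Proof.
move=> cover; apply: contrapT => none.
have step (t : nat * (X * R)) : exists s : X * R, 0 < t.2.2 ->
    [/\ 0 < s.2, s.2 <= 2^-1 ^+ t.1.+1, N (s.1 - t.2.1) + s.2 <= t.2.2
      & forall x, F t.1 x -> s.2 < N (s.1 - x)].
  (* The value (0, 0) for a nonpositive radius only makes the choice function total. *)
  case: t => m [x0 r] /=; have [r0|] := ltP 0 r; last by exists (0, 0).
  apply: contrapT => bad; apply: none; exists m, x0, (r / 2).
  split; first by rewrite divr_gt0.
  move=> x xr e e0; apply: contrapT => away; apply: bad.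
  exists (x, Num.min e (Num.min (r / 2) (2^-1 ^+ m.+1))) => _ /=; split.
  - by rewrite !lt_min e0 divr_gt0//= exprn_gt0.
  - by rewrite !ge_min lexx !orbT.
  - have : Num.min e (Num.min (r / 2) (2^-1 ^+ m.+1)) <= r / 2.
      by rewrite !ge_min lexx !orbT.
    by lra.
  - move=> x' Fx'; rewrite ltNge; apply/negP => le; apply: away; exists x' => //.
    by rewrite (le_trans le)// ge_min lexx.
have [g gP] := choice step.
(* Ball [n.+1] avoids [F n], so the limit is compared with ball [m.+1] at the end. *)
pose fix s n := if n is p.+1 then g (p, s p) else (0, 1) : X * R.
have s0 n : 0 < (s n).2 by elim: n => //= n IH; have [] := gP (n, s n) IH.
have sP n := gP (n, s n) (s0 n).
have sr n : (s n).2 <= 2^-1 ^+ n by case: n => [|n]; [rewrite expr0|case: (sP n)].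
have nest n k : N ((s (n + k)%N).1 - (s n).1) + (s (n + k)%N).2 <= (s n).2.
  elim: k => [|k IH]; first by rewrite addn0 subrr seminorm0 add0r.
  have [_ _ + _] := sP (n + k)%N; rewrite addnS /=.
  have := seminorm_dist (s (n + k)%N).1 (g ((n + k)%N, s (n + k)%N)).1 (s n).1.
  by lra.
have [i|l Hl] := cN (fun n => (s n).1).
  by have := nest i 1%N; rewrite addn1; have := s0 i.+1; have := sr i; lra.
have Hin n : N ((s n).1 - l) <= (s n).2.
  apply/ler_addgt0Pr => e /Hl[m Hm].
  have := Hm (n + m)%N (leq_addl _ _); have := nest n m.
  have := seminorm_dist (s (n + m)%N).1 (s n).1 l.
  by rewrite (seminorm_distC _ (s (n + m)%N).1); have := s0 (n + m)%N; lra.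
have [m Fm] := cover l.
by have [_ _ _ /(_ l Fm)] := sP m; rewrite ltNge (Hin m.+1).
Qed.

Lemma uniform_boundedness (cN : complete_seminorm N) (I : Type)
    (phi : I -> X -> R) :
  (forall i x y, phi i (x + y) = phi i x + phi i y) ->
  (forall i (a : R) x, phi i (a%:C *: x) = a * phi i x) ->
  (forall i, exists c, forall x, `|phi i x| <= c * N x) ->
  (forall x, exists M, forall i, `|phi i x| <= M) ->
  exists2 C, 0 <= C & forall i x, `|phi i x| <= C * N x.
Proof.
move=> phiD phiZ phi_bnd ptw.
have [|m [x0 [r [r0 Hr]]]] :=
    @seminorm_baire cN (fun m x => forall i, `|phi i x| <= m%:R).
  move=> x; have [M HM] := ptw x; exists (Num.bound `|M|) => i.
  apply: (le_trans (HM i)); apply/ltW/(le_lt_trans (ler_norm M)).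
  exact: archi_boundP.
(* Continuity of each [phi i] upgrades density in the ball to a bound at every point of it. *)
have closed i x : N (x - x0) <= r -> `|phi i x| <= m%:R.
  move=> xr; have [c Hc] := phi_bnd i.
  rewrite -subr_le0; apply: (@le0_eps _ `|c|) => e e0 _.
  have [x' Fx' xx'] := Hr x xr e e0.
  have := Fx' i; have := Hc (x - x').
  have := ler_normD (phi i (x - x')) (phi i x'); rewrite -phiD subrK.
  have : c * N (x - x') <= `|c| * e.
    apply: (@le_trans _ _ (`|c| * N (x - x'))); last exact: ler_wpM2l.
    by rewrite ler_wpM2r ?ler_norm ?seminorm_ge0.
  lra.
have ball i x : N x <= r -> `|phi i x| <= 2 * m%:R.
  move=> xr; have := closed i (x + x0); rewrite addrK => /(_ xr).
  have := closed i x0; rewrite subrr seminorm0 => /(_ (ltW r0)).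
  rewrite phiD; have := ler_normB (phi i x + phi i x0) (phi i x0).
  by rewrite addrK; lra.
exists (2 * m%:R / r); first by rewrite divr_ge0 ?(ltW r0)// mulr_ge0.
move=> i x; have [Nx0|Nx0] := eqVneq (N x) 0.
  by have [c /(_ x)] := phi_bnd i; rewrite Nx0 !mulr0.
have Nxp : 0 < N x by rewrite lt_def Nx0 seminorm_ge0.
have := ball i ((r / N x)%:C *: x); rewrite (seminormZ sN) phiZ (normrM (r / _)).
rewrite gtr0_norm ?divr_gt0// divfK// lexx => /(_ isT).
rewrite mulrAC ler_pdivrMr// => H.
by rewrite mulrAC ler_pdivlMr// mulrC.
Qed.

End One.

(** An open mapping theorem for seminorms. Baire for [N2] makes some [N1]-ball [N2]-dense in an
    [N2]-ball; successive approximation, summed in [N1], turns density into exact equality modulo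
    [N2]-null vectors. It serves both to lift along [V] and to compare [NH] with the graph norm. *)
Lemma comparison X (N1 N2 : X -> R) (c : R) :
  seminorm N1 -> seminorm N2 -> complete_seminorm N1 -> complete_seminorm N2 ->
  (forall x, N2 x <= c * N1 x) ->
  exists2 C, 0 <= C &
    forall x, exists x', N2 (x - x') = 0 /\ N1 x' <= C * N2 x.
Proof.
move=> s1 s2 c1 c2 N21.
have [|m [x0 [r [r0 Hr]]]] := seminorm_baire s2 c2 (F := fun m x => N1 x <= m%:R).
  by move=> x; exists (Num.bound (N1 x)); apply/ltW/archi_boundP/seminorm_ge0.
have ball x : N2 x <= r ->
    exists x', N1 x' <= 2 * m%:R /\ N2 (x - x') <= r / 2.
  move=> xr; have r4 : 0 < r / 4 by rewrite divr_gt0.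
  have [|a am xa] := Hr (x + x0) _ _ r4; first by rewrite addrK.
  have [|b bm xb] := Hr x0 _ _ r4; first by rewrite subrr seminorm0 ?ltW.
  exists (a - b); split; first by have := seminormB s1 a b; lra.
  have -> : x - (a - b) = (x + x0 - a) - (x0 - b).
    by rewrite !opprB (addrAC x) addrACA subrr addr0 addrA addrAC.
  by have := seminormB s2 (x + x0 - a) (x0 - b); lra.
(* Rescaling [x] to [N2]-size r gives 2m / r; the added 1 keeps [M] positive. *)
pose M := (2 * m%:R + 1) / r.
have M0 : 0 < M by rewrite divr_gt0// ltr_wpDl// mulr_ge0.
have step x : exists x', N1 x' <= M * N2 x /\ N2 (x - x') <= 2^-1 * N2 x.
  have [Nx0|Nx0] := eqVneq (N2 x) 0.
    by exists 0; rewrite subr0 Nx0 !mulr0 seminorm0.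
  have Nxp : 0 < N2 x by rewrite lt_def Nx0 seminorm_ge0.
  have t0 : 0 < N2 x / r by rewrite divr_gt0.
  have [|x' [x'm xx']] := ball ((N2 x / r)^-1%:C *: x).
    by rewrite (seminormZ s2) gtr0_norm ?invr_gt0// invf_div divfK.
  exists ((N2 x / r)%:C *: x'); split.
    rewrite (seminormZ s1) gtr0_norm//.
    have -> : M * N2 x = N2 x / r * (2 * m%:R + 1) by rewrite /M; ring.
    by apply: ler_wpM2l; [exact: ltW|lra].
  have -> : x - (N2 x / r)%:C *: x' =
            (N2 x / r)%:C *: ((N2 x / r)^-1%:C *: x - x').
    by rewrite scalerBr scalerA -rmorphM mulfV ?gt_eqF// scale1r.
  rewrite (seminormZ s2) gtr0_norm//.
  apply: le_trans (ler_wpM2l (ltW t0) xx') _.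
  by rewrite mulrA divfK ?gt_eqF// mulrC.
have [g gP] := choice step.
exists (2 * M); first by rewrite mulr_ge0// ltW.
move=> x; have [Nx0|Nx0] := eqVneq (N2 x) 0.
  by exists 0; rewrite subr0 Nx0 !mulr0 seminorm0.
(* [y n] is the residue after n corrections, so [x - y n] is the partial sum. Division by [D]
   normalises its increments to 2^-n. *)
pose y := fix y n := if n is p.+1 then y p - g (y p) else x.
have yP n : N2 (y n) <= 2^-1 ^+ n * N2 x.
  elim: n => [|n IH]; first by rewrite expr0 mul1r.
  by have [_] := gP (y n); rewrite /= exprS; lra.
pose D := M * N2 x.
have D0 : 0 < D by rewrite mulr_gt0// lt_def Nx0 seminorm_ge0.
have [i|l Hl] := geometric_limit s1 c1 (u := fun n => D^-1%:C *: (x - y n)).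
  rewrite -scalerBr (seminormZ s1) gtr0_norm ?invr_gt0// mulrC ler_pdivrMr//.
  have -> : x - y i.+1 - (x - y i) = g (y i).
    by rewrite /= !opprB addrC addrA subrK addrC subrK.
  have [+ _] := gP (y i); have := yP i; rewrite /D.
  set P := _ ^+ i; nra.
exists (D%:C *: l); split.
  apply/eqP; rewrite eq_le seminorm_ge0// andbT.
  apply: (@le0_eps _ (N2 x + `|c| * (D * 2))) => e e0 _.
  have [k /(_ _ (leqnn _)) ke] := expn_half_small e0.
  have -> : x - D%:C *: l = y k + D%:C *: (D^-1%:C *: (x - y k) - l).
    rewrite scalerBr scalerA -rmorphM mulfV ?gt_eqF// scale1r.
    by rewrite addrA (addrC (y k)) subrK.
  have := seminormD s2 (y k) (D%:C *: (D^-1%:C *: (x - y k) - l)).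
  rewrite (seminormZ s2) (gtr0_norm D0).
  set z := _ - l.
  have := yP k; have := N21 z; have := Hl k; rewrite -/z.
  have := ler_norm c; have : 0 <= `|c| by [].
  have := seminorm_ge0 s1 z; have := seminorm_ge0 s2 x.
  have pk : 0 <= 2^-1 ^+ k :> R by rewrite exprn_ge0.
  set P := 2^-1 ^+ k in ke pk * => N2x N1z c0 cc N1zP N2z N2y.
  have : N2 z <= `|c| * (2 * e).
    apply: (le_trans N2z); apply: (@le_trans _ _ (`|c| * N1 z)); first by nra.
    by apply: ler_wpM2l => //; lra.
  set A := `|c| * _ => N2zA tri.
  have : D * N2 z <= D * (`|c| * (2 * e)) by apply: ler_wpM2l => //; exact: ltW.
  have : P * N2 x <= e * N2 x by apply: ler_wpM2r.
  by lra.
have -> : 2 * M * N2 x = D * 2 by rewrite /D; ring.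
rewrite (seminormZ s1) (gtr0_norm D0).
apply: ler_wpM2l; first exact: ltW.
(* At index 0 the partial sum is 0, so [N1 l <= 2]. *)
have := Hl 0; rewrite subrr scaler0 sub0r (seminormN s1) expr0; lra.
Qed.

End Seminorms.

(** * Real parts of hermitian forms *)

Section RealForms.
Variable R : realType.
Implicit Types X Y : lmodType R[i].

(* The rotation invariance [real_form_i] is all that is kept of the complex
   structure. *)
Record real_form X (k : X -> X -> R) : Prop := {
  real_formC : forall x y, k x y = k y x ;
  real_formDl : forall x y z, k (x + y) z = k x z + k y z ;
  real_formZl : forall (a : R) x y, k (a%:C *: x) y = a * k x y ;
  real_form_i : forall x y, k ('i%C *: x) ('i%C *: y) = k x y }.

Lemma real_form_comp X Y (k : Y -> Y -> R) (f : {linear X -> Y}) :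
  real_form k -> real_form (fun x y => k (f x) (f y)).
Proof.
move=> [kC kDl kZl ki]; split=> [x y|x y z|a x y|x y].
- exact: kC.
- by rewrite linearD kDl.
- by rewrite linearZ kZl.
- by rewrite !linearZ ki.
Qed.

Lemma real_form_lin X (p q : X -> X -> R) (a : R) :
  real_form p -> real_form q -> real_form (fun x y => q x y + a * p x y).
Proof.
move=> [pC pDl pZl pi] [qC qDl qZl qi]; split=> [x y|x y z|b x y|x y].
- by rewrite pC qC.
- by rewrite pDl qDl; ring.
- by rewrite pZl qZl; ring.
- by rewrite pi qi.
Qed.

Section Theory.
Variables (X : lmodType R[i]) (k : X -> X -> R) (rk : real_form k).

Lemma real_formDr x y z : k x (y + z) = k x y + k x z.
Proof. by rewrite (real_formC rk) (real_formDl rk) !(real_formC rk _ x). Qed.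

Lemma real_formZr (a : R) x y : k x (a%:C *: y) = a * k x y.
Proof. by rewrite (real_formC rk) (real_formZl rk) (real_formC rk y). Qed.

Lemma real_formNl x y : k (- x) y = - k x y.
Proof.
have := real_formZl rk (-1) x y.
by rewrite rmorphN rmorph1 scaleN1r mulN1r.
Qed.

Lemma real_formNr x y : k x (- y) = - k x y.
Proof. by rewrite (real_formC rk) real_formNl (real_formC rk y). Qed.

Lemma real_form0 : k 0 0 = 0.
Proof. by rewrite -(scaler0 X (0%:C)) (real_formZl rk) mul0r. Qed.

Lemma real_form_sqrD x y : k (x + y) (x + y) = k x x + 2 * k x y + k y y.
Proof.
rewrite (real_formDl rk) !real_formDr (real_formC rk y x); ring.
Qed.

Lemma real_form_sqrB x y : k (x - y) (x - y) = k x x - 2 * k x y + k y y.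
Proof. by rewrite real_form_sqrD real_formNr real_formNl real_formNr; ring. Qed.

Lemma real_form_sqrZ (a : R) x : k (a%:C *: x) (a%:C *: x) = a ^+ 2 * k x x.
Proof. by rewrite (real_formZl rk) real_formZr mulrA. Qed.

(** Rotating both arguments by i turns the value into [k (ix) (-x)], its own opposite. *)
Lemma real_form_ii x : k x ('i%C *: x) = 0.
Proof.
have := real_form_i rk x ('i%C *: x).
rewrite scalerA -expr2 sqr_i scaleN1r real_formNr (real_formC rk _ x); lra.
Qed.

Lemma real_form_rotation (c d : R) x :
  k (c%:C *: x + d%:C *: ('i%C *: x)) (c%:C *: x + d%:C *: ('i%C *: x)) =
  (c ^+ 2 + d ^+ 2) * k x x.
Proof.
rewrite real_form_sqrD !real_form_sqrZ (real_formZl rk) real_formZr.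
by rewrite real_form_ii (real_form_i rk); ring.
Qed.

Lemma cauchy_schwarz : (forall x, 0 <= k x x) ->
  forall x y, k x y ^+ 2 <= k x x * k y y.
Proof.
move=> k0 x y.
have H (t : R) : 0 <= k x x - 2 * t * k x y + t ^+ 2 * k y y.
  have := k0 (x - t%:C *: y).
  by rewrite real_form_sqrB real_form_sqrZ real_formZr mulrA.
have [y0|y0] := eqVneq (k y y) 0.
  suff -> : k x y = 0 by rewrite expr0n y0 mulr0.
  apply/eqP/negPn/negP => xy0.
  (* With [k y y = 0] the quadratic [H] is affine in t; this t makes it equal to -1. *)
  have := H ((k x x + 1) / (2 * k x y)); rewrite y0 mulr0 addr0.
  have -> : 2 * ((k x x + 1) / (2 * k x y)) * k x y = k x x + 1.
    by field.
  by lra.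
have yp : 0 < k y y by rewrite lt_def y0 k0.
have := H (k x y / k y y).
have -> : k x x - 2 * (k x y / k y y) * k x y + (k x y / k y y) ^+ 2 * k y y =
   (k x x * k y y - k x y ^+ 2) / k y y by field.
by rewrite pmulr_lge0 ?invr_gt0// subr_ge0.
Qed.

End Theory.

Lemma unit_orthogonal (u v : R) :
  exists c d, c ^+ 2 + d ^+ 2 = 1 /\ c * u + d * v = 0.
Proof.
have [uv0|uv0] := eqVneq (u ^+ 2 + v ^+ 2) 0.
  exists 1, 0; split; first by rewrite expr1n expr0n addr0.
  have /eqP : u ^+ 2 == 0.
    by rewrite eq_le sqr_ge0 andbT -uv0 lerDl sqr_ge0.
  by move/eqP; rewrite sqrf_eq0 => /eqP ->; rewrite !mul0r mulr0 addr0.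
have uvp : 0 < u ^+ 2 + v ^+ 2 by rewrite lt_def uv0 addr_ge0 ?sqr_ge0.
pose n := Num.sqrt (u ^+ 2 + v ^+ 2).
have n0 : n != 0 by rewrite gt_eqF// sqrtr_gt0.
have n2 : n ^+ 2 = u ^+ 2 + v ^+ 2 by rewrite sqr_sqrtr// ltW.
exists (- v / n), (u / n); split; last by ring.
have -> : (- v / n) ^+ 2 + (u / n) ^+ 2 = (u ^+ 2 + v ^+ 2) / n ^+ 2 by field.
by rewrite n2 divff.
Qed.

(** A suitable [a] must lie above all -q/p where p > 0 and below all q/(-p) where p < 0. [key] shows
    that these two sets of ratios are separated, so the supremum of the first works. *)
Lemma S_lemma X (p q : X -> X -> R) : real_form p -> real_form q ->
  (forall x, p x x = 0 -> 0 <= q x x) ->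
  (exists x, 0 < p x x) -> (exists x, p x x < 0) ->
  exists a : R, forall x, 0 <= q x x + a * p x x.
Proof.
move=> rp rq q_cone [x0 px0] [y0 py0].
have key x y : 0 < p x x -> p y y < 0 -> - q x x / p x x <= q y y / - p y y.
  move=> px py.
  have [c [d [cd1 orth]]] := unit_orthogonal (p x y) (p x ('i%C *: y)).
  (* a unimodular complex multiple of y that is p-orthogonal to x *)
  pose z := c%:C *: y + d%:C *: ('i%C *: y).
  have pz : p z z = p y y by rewrite real_form_rotation// cd1 mul1r.
  have qz : q z z = q y y by rewrite real_form_rotation// cd1 mul1r.
  have pxz : p x z = 0 by rewrite (real_formDr rp) !(real_formZr rp).
  have pyN : 0 < - p y y by rewrite oppr_gt0.
  have st0 : 0 <= p x x / - p y y by rewrite divr_ge0 ?ltW.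
  pose s := Num.sqrt (p x x / - p y y).
  have s2 : s ^+ 2 = p x x / - p y y by rewrite sqr_sqrtr.
  have s2p : s ^+ 2 * p y y = - p x x.
    by rewrite s2 invrN mulrN mulNr divfK// lt_eqF.
  (* Both x + sz and x - sz lie on the cone p = 0; adding the two inequalities cancels the cross
     term of q. *)
  have := q_cone (x + s%:C *: z); rewrite (real_form_sqrD rp) (real_form_sqrZ rp).
  rewrite (real_formZr rp) pxz pz s2p !mulr0 addr0 subrr => /(_ erefl).
  have := q_cone (x - s%:C *: z); rewrite (real_form_sqrB rp) (real_form_sqrZ rp).
  rewrite (real_formZr rp) pxz pz s2p !mulr0 subr0 subrr => /(_ erefl).
  rewrite (real_form_sqrB rq) (real_form_sqrD rq) (real_form_sqrZ rq) qz s2.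
  move=> h1 h2.
  rewrite ler_pdivrMr//.
  have -> : q y y / - p y y * p x x = p x x / - p y y * q y y by ring.
  by lra.
pose S := [set - q x x / p x x | x in [set x | 0 < p x x]].
have S0 : S !=set0 by exists (- q x0 x0 / p x0 x0), x0.
have ubS : has_ubound S by exists (q y0 y0 / - p y0 y0) => _ [x px <-]; exact: key.
exists (sup S) => x; have [px|px|px] := ltgtP (p x x) 0.
- have : sup S <= q x x / - p x x by apply: ge_sup => // _ [y py <-]; exact: key.
  by rewrite ler_pdivlMr ?oppr_gt0//; lra.
- have : - q x x / p x x <= sup S by apply: ub_le_sup => //; exists x.
  by rewrite ler_pdivrMr//; lra.
- by rewrite px mulr0 addr0 q_cone.
Qed.

End RealForms.

(** * Coercivity on the neutral cone *)

Section Coercivity.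
Variable R : realType.
Implicit Types X : lmodType R[i].

(** The [y] in [krein_symmetry] plays the role of Jx for a fundamental symmetry J. The factor 2 is
    what polarisation yields in [real_form_bound]. *)
Record krein_form X (N : X -> R) (k : X -> X -> R) : Prop := {
  krein_real : real_form k ;
  krein_bound : forall x y, `|k x y| <= 2 * (N x * N y) ;
  krein_symmetry : forall x, exists y, k x y = N x ^+ 2 /\ N y = N x }.

Variables (H K E : lmodType R[i]) (NH : H -> R) (NK : K -> R) (NE : E -> R).
Hypotheses (sH : seminorm NH) (sK : seminorm NK) (sE : seminorm NE).
Hypotheses (cH : complete_seminorm NH) (cK : complete_seminorm NK).
Hypothesis (cE : complete_seminorm NE).
Hypotheses (NK_eq0 : forall w, NK w = 0 -> w = 0).
Hypotheses (NE_eq0 : forall z, NE z = 0 -> z = 0).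
Variables (kK : K -> K -> R) (kE : E -> E -> R).
Hypotheses (kfK : krein_form NK kK) (kfE : krein_form NE kE).
Variables (T : {linear H -> K}) (V : {linear H -> E}) (cT cV : R).
Hypotheses (cT0 : 0 <= cT) (cV0 : 0 <= cV).
Hypotheses (bT : forall x, NK (T x) <= cT * NH x).
Hypotheses (bV : forall x, NE (V x) <= cV * NH x).
Hypothesis surjV : forall z, exists x, V x = z.
Hypothesis T_neg : exists x, kK (T x) (T x) < 0.
Hypotheses (V_pos : exists x, 0 < kE (V x) (V x)).
Hypotheses (V_neg : exists x, kE (V x) (V x) < 0).
Hypothesis kerTV : forall x, T x = 0 -> V x = 0 -> x = 0.
Hypothesis solvable : forall w z, exists2 x, kE (V x - z) (V x - z) = 0 &
  forall x', kE (V x' - z) (V x' - z) = 0 ->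
  kK (T x - w) (T x - w) <= kK (T x' - w) (T x' - w).

Let rK := krein_real kfK.
Let rE := krein_real kfE.

Let Q x := kK (T x) (T x).
Let P x := kE (V x) (V x).

Let PZ (a : R) y : P (a%:C *: y) = a ^+ 2 * P y.
Proof. by rewrite /P linearZ (real_form_sqrZ rE). Qed.

Let QZ (a : R) y : Q (a%:C *: y) = a ^+ 2 * Q y.
Proof. by rewrite /Q linearZ (real_form_sqrZ rK). Qed.

Lemma form_dominates_T_on_cone :
  exists2 C, 0 <= C & forall y, P y = 0 -> NK (T y) ^+ 2 <= C * Q y.
Proof.
pose I := {y : H | P y = 0 /\ Q y <= 1}.
(* Expanding the objective at y, a competitor for z = 0, and using [Q y <= 1] bounds the linear term
   from above; replacing y by -y later gives the other side. *)
have half_bound w : exists M, forall y, P y = 0 -> Q y <= 1 -> kK (T y) w <= M.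
  have [x _ xmin] := solvable w 0.
  exists ((1 + kK w w - kK (T x - w) (T x - w)) / 2) => y Py Qy.
  have := xmin y; rewrite subr0 => /(_ Py).
  rewrite [leRHS](real_form_sqrB rK) -/(Q y); lra.
have [||||C C0 HC] := uniform_boundedness sK cK (I := I)
    (phi := fun i w => kK (T (sval i)) w).
- by move=> i x y; rewrite (real_formDr rK).
- by move=> i a x; rewrite (real_formZr rK).
- move=> i; exists (2 * NK (T (sval i))) => x.
  by rewrite -mulrA; exact: krein_bound kfK _ _.
- move=> w; have [M HM] := half_bound w; exists M => -[y [Py Qy]] /=.
  rewrite ler_norml lerNl HM// andbT.
  have := HM ((-1)%:C *: y); rewrite PZ QZ sqrrN expr1n !mul1r => /(_ Py Qy).
  by rewrite linearZ (real_formZl rK) mulN1r.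
have cone1 y : P y = 0 -> Q y <= 1 -> NK (T y) <= C.
  (* At j = J(Ty) the uniform bound reads |Ty|^2 <= C |Ty|. *)
  move=> Py Qy; have [j [kj Nj]] := krein_symmetry kfK (T y).
  have := HC (exist _ y (conj Py Qy)) j; rewrite /= kj Nj.
  rewrite ger0_norm ?sqr_ge0// expr2.
  have [->//|Ty0] := eqVneq (NK (T y)) 0.
  by rewrite ler_pM2r// lt_def Ty0 seminorm_ge0.
(* Scaling by a free s, instead of the root of [Q y], also covers [Q y <= 0]: letting s tend to 0
   then forces |Ty| = 0. *)
have cone y s : P y = 0 -> 0 < s -> Q y <= s ^+ 2 -> NK (T y) <= C * s.
  move=> Py s0 Qy; have := cone1 (s^-1%:C *: y); rewrite PZ QZ Py mulr0.
  rewrite exprVn mulrC ler_pdivrMr ?exprn_gt0// mul1r => /(_ erefl Qy).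
  rewrite linearZ (seminormZ sK) gtr0_norm ?invr_gt0//.
  by rewrite mulrC ler_pdivrMr.
exists (C ^+ 2); first exact: sqr_ge0.
move=> y Py; have [Q0|Q0] := ltP 0 (Q y).
  have s0 : 0 < Num.sqrt (Q y) by rewrite sqrtr_gt0.
  have := cone y _ Py s0; rewrite (sqr_sqrtr (ltW Q0)) lexx => /(_ isT) le.
  rewrite -(sqr_sqrtr (ltW Q0)) -exprMn ler_pXn2r// nnegrE.
    by rewrite seminorm_ge0.
  by rewrite mulr_ge0// ltW.
have Ty0 : NK (T y) = 0.
  apply/eqP; rewrite eq_le seminorm_ge0// andbT.
  apply: (@le0_eps _ _ C) => e e0 _; rewrite mulrC; apply: cone => //.
  by rewrite (le_trans Q0)// sqr_ge0.
have := krein_bound kfK (T y) (T y); rewrite -/(Q y) Ty0 mul0r mulr0 normr_le0.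
by move=> /eqP ->; rewrite expr0n mulr0.
Qed.

Lemma form_ge0_on_cone y : P y = 0 -> 0 <= Q y.
Proof.
have [C C0 HC] := form_dominates_T_on_cone => Py.
rewrite leNgt; apply/negP => Q0.
have T0 : NK (T y) = 0.
  apply/eqP; rewrite -sqrf_eq0 eq_le sqr_ge0 andbT (le_trans (HC y Py))//.
  by rewrite mulr_ge0_le0// ltW.
have := krein_bound kfK (T y) (T y); rewrite -/(Q y) T0 mul0r mulr0 normr_le0.
by move=> /eqP Q00; rewrite Q00 ltxx in Q0.
Qed.

(** Open mapping for [V]: surjectivity makes the seminorm [x |-> NE (V x)] complete, so [comparison]
    applies. *)
Lemma surjection_lift :
  exists2 C, 0 <= C & forall z, exists2 x, V x = z & NH x <= C * NE z.
Proof.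
have sV : seminorm (fun x => NE (V x)).
  split=> [x y|a x]; first by rewrite linearD; exact: (seminormD sE).
  by rewrite linearZ (seminormZ sE).
have [|C C0 HC] := comparison sH sV cH _ bV.
  move=> u Hu; have [i|z Hz] := cE (u := fun i => V (u i)).
    by rewrite -linearB; exact: Hu.
  have [l Vl] := surjV z; exists l => e /Hz[m Hm]; exists m => i /Hm.
  by rewrite linearB Vl.
exists C => // z; have [x0 Vx0] := surjV z; have [x [+ Nx]] := HC x0.
rewrite linearB => /NE_eq0/eqP; rewrite subr_eq0 => /eqP Vx.
by exists x; rewrite -?Vx -Vx0.
Qed.

Lemma form_dominates_V_on_cone :
  exists2 C, 0 <= C & forall y, P y = 0 -> NE (V y) ^+ 2 <= C * Q y.
Proof.
have [C1 C10 HC1] := form_dominates_T_on_cone.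
have [Cv Cv0 HCv] := surjection_lift.
have rq := real_form_comp T rK; have rp := real_form_comp V rE.
have [|a Sge0] := S_lemma rp rq _ V_pos V_neg; first exact: form_ge0_on_cone.
have rs := real_form_lin a rp rq.
have CS := cauchy_schwarz rs Sge0.
have a0 : a != 0.
  apply/eqP => a0; have [x] := T_neg; have := Sge0 x.
  by rewrite a0 mul0r addr0; lra.
have a2 : 0 < a ^+ 2 by rewrite lt_def sqrf_eq0 a0 sqr_ge0.
pose D := 2 * cT ^+ 2 + `|a| * (2 * cV ^+ 2).
have D0 : 0 <= D by rewrite addr_ge0 ?mulr_ge0 ?sqr_ge0.
have SD x : kK (T x) (T x) + a * kE (V x) (V x) <= D * NH x ^+ 2.
  have := le_trans (ler_norm _) (krein_bound kfK (T x) (T x)).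
  have := krein_bound kfE (V x) (V x).
  have : NK (T x) * NK (T x) <= cT ^+ 2 * NH x ^+ 2.
    by rewrite -exprMn expr2 ler_pM ?bT ?seminorm_ge0.
  have : NE (V x) * NE (V x) <= cV ^+ 2 * NH x ^+ 2.
    by rewrite -exprMn expr2 ler_pM ?bV ?seminorm_ge0.
  set p := kE _ _; set q := kK _ _ => VV TT bp bq.
  have : a * p <= `|a| * (2 * (cV ^+ 2 * NH x ^+ 2)).
    rewrite (le_trans (ler_norm _))// normrM ler_wpM2l//; lra.
  by rewrite /D; lra.
(* With q = [Ty, Tx] and n = |Vy|, the final estimate is (a n^2)^2 <= 2 (q + a n^2)^2 + 2 q^2.
   Cauchy-Schwarz contributes 2D, the bound on q contributes 8 C1 cT^2, and |x| <= Cv n gives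
   Cv^2. *)
pose G := (2 * D + 8 * C1 * cT ^+ 2) * Cv ^+ 2 / a ^+ 2.
have G0 : 0 <= G.
  by rewrite divr_ge0 ?sqr_ge0// mulr_ge0 ?sqr_ge0// addr_ge0// !mulr_ge0 ?sqr_ge0.
exists G => // y Py.
have T1 := HC1 y Py.
have [Vy0|Vy0] := eqVneq (NE (V y)) 0.
  rewrite Vy0 expr0n /=; have := Sge0 y; rewrite -/(P y) Py mulr0 addr0 => Q0.
  exact: mulr_ge0.
have Vyp : 0 < NE (V y) by rewrite lt_def Vy0 seminorm_ge0.
have [j [kj Nj]] := krein_symmetry kfE (V y).
have [x Vx Nx] := HCv j; rewrite Nj in Nx.
have := CS y x; rewrite -/(P y) Py mulr0 addr0 Vx kj -/(Q y).
have := Sge0 y; rewrite -/(P y) Py mulr0 addr0 -/(Q y) => Q0.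
set q := kK (T y) (T x); rewrite -Vx.
have := SD x; set sx := _ + _ => sxD.
have Nx2 : NH x ^+ 2 <= Cv ^+ 2 * NE (V y) ^+ 2.
  by rewrite -exprMn ler_pXn2r// nnegrE ?seminorm_ge0// mulr_ge0 ?seminorm_ge0.
have q2 : q ^+ 2 <= 4 * (C1 * Q y) * (cT ^+ 2 * NH x ^+ 2).
  rewrite -real_normK ?num_real//.
  have : `|q| ^+ 2 <= (2 * (NK (T y) * NK (T x))) ^+ 2.
    by rewrite ler_pXn2r ?nnegrE ?(krein_bound kfK)// !mulr_ge0 ?seminorm_ge0.
  move/le_trans; apply.
  have -> : (2 * (NK (T y) * NK (T x))) ^+ 2 =
            4 * NK (T y) ^+ 2 * NK (T x) ^+ 2 by ring.
  apply: ler_pM; rewrite ?mulr_ge0 ?sqr_ge0 ?seminorm_ge0 ?ler_wpM2l//.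
  by rewrite -exprMn ler_pXn2r ?nnegrE ?bT ?mulr_ge0 ?seminorm_ge0.
set n := NE (V y) in Vyp Nx Nx2 *.
move=> cs.
have : (a * n ^+ 2) ^+ 2 <= G * a ^+ 2 * Q y * n ^+ 2.
  have h1 : (a * n ^+ 2) ^+ 2 <= 2 * (q + a * n ^+ 2) ^+ 2 + 2 * q ^+ 2.
    (* The right side minus the left side is exactly this square. *)
    by have := sqr_ge0 (2 * q + a * n ^+ 2); lra.
  have h2 : Q y * sx <= Q y * (D * (Cv ^+ 2 * n ^+ 2)).
    by rewrite ler_wpM2l// (le_trans sxD)// ler_wpM2l.
  have h3 : 4 * (C1 * Q y) * (cT ^+ 2 * NH x ^+ 2) <=
            4 * (C1 * Q y) * (cT ^+ 2 * (Cv ^+ 2 * n ^+ 2)).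
    by rewrite ler_wpM2l ?mulr_ge0// ler_wpM2l ?sqr_ge0.
  rewrite /G divfK ?gt_eqF//; lra.
have n2 : 0 < a ^+ 2 * n ^+ 2 by rewrite mulr_gt0// exprn_gt0.
have -> : (a * n ^+ 2) ^+ 2 = n ^+ 2 * (a ^+ 2 * n ^+ 2) by ring.
have -> : G * a ^+ 2 * Q y * n ^+ 2 = G * Q y * (a ^+ 2 * n ^+ 2) by ring.
by rewrite ler_pM2r.
Qed.

Lemma form_dominates_on_cone :
  exists2 C, 0 < C & forall y, P y = 0 ->
    NK (T y) ^+ 2 <= C * Q y /\ NE (V y) ^+ 2 <= C * Q y.
Proof.
have [C1 C10 H1] := form_dominates_T_on_cone.
have [C2 C20 H2] := form_dominates_V_on_cone.
exists (C1 + C2 + 1); first by lra.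
move=> y Py; have := H1 y Py; have := H2 y Py.
have Q0 := form_ge0_on_cone Py.
have := mulr_ge0 C10 Q0; have := mulr_ge0 C20 Q0; rewrite !mulrDl mul1r.
by move=> ? ? ? ?; split; lra.
Qed.

Lemma graph_limit w z :
  (forall e, 0 < e -> exists2 x, V x = z & NK (T x - w) <= e) ->
  exists2 y, T y = w & V y = z.
Proof.
move=> Hwz; have [C C0 HC] := form_dominates_on_cone.
have [y Vyz ymin] := solvable w z.
pose a := T y - w.
have near0 e : 0 < e -> exists u v, [/\ NK (a - u) <= e, NK u ^+ 2 <= C * v,
    NE (V y - z) ^+ 2 <= C * v & v <= 4 * e ^+ 2 + 4 * e * NK a].
  move=> e0; have [x Vx Tx] := Hwz e e0.
  (* As Vx = z, the difference y - x is on the cone. With d = Tx - w, minimality gives [a, a] <=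
     [d, d], so Q(y - x) <= 2 [d, d] - 2 [a, d], which is small with e. *)
  exists (T (y - x)), (Q (y - x)).
  have Pyx : P (y - x) = 0 by rewrite /P linearB Vx.
  have [TQ] := HC _ Pyx; rewrite [V _]linearB Vx => VQ; split=> //.
    by rewrite linearB /a opprB addrC addrA subrK.
  have -> : Q (y - x) = kK (a - (T x - w)) (a - (T x - w)).
    by rewrite /Q linearB /a opprB addrA subrK.
  rewrite (real_form_sqrB rK).
  have : kK a a <= kK (T x - w) (T x - w).
    by apply: ymin; rewrite Vx subrr (real_form0 rE).
  have := le_trans (ler_norm _) (krein_bound kfK (T x - w) (T x - w)).
  have := krein_bound kfK a (T x - w); rewrite ler_norml => /andP[+ _].
  set d := T x - w in Tx *.
  have : NK d * NK d <= e * e by rewrite ler_pM ?seminorm_ge0.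
  have : NK a * NK d <= NK a * e by rewrite ler_wpM2l ?seminorm_ge0.
  by rewrite expr2; lra.
exists y; apply/eqP; rewrite -subr_eq0; apply/eqP.
  apply: NK_eq0; apply/eqP; rewrite -sqrf_eq0 eq_le sqr_ge0 andbT.
  (* From |a|^2 <= (e + |u|)^2 <= 2 e^2 + 2 |u|^2, with |u|^2 <= C v and e^2 <= e. *)
  apply: (@le0_eps _ _ (2 * (C * (4 + 4 * NK a)) + 2)) => e e0 e1.
  have [u [v [au Tu _ ve]]] := near0 e e0; rewrite -/a.
  have tri : NK a <= e + NK u.
    by apply: le_trans (lerD au (lexx _)); rewrite -{1}(subrK u a) (seminormD sK).
  have ee : e ^+ 2 <= e by rewrite expr2 ler_piMr// ltW.
  have : C * v <= C * (e * (4 + 4 * NK a)) by rewrite ler_pM2l//; lra.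
  have : NK a ^+ 2 <= (e + NK u) ^+ 2.
    by rewrite ler_pXn2r ?nnegrE ?seminorm_ge0// addr_ge0 ?seminorm_ge0 ?ltW.
  have := sqr_ge0 (e - NK u); lra.
apply: NE_eq0; apply/eqP; rewrite -sqrf_eq0 eq_le sqr_ge0 andbT.
apply: (@le0_eps _ _ (C * (4 + 4 * NK a))) => e e0 e1.
have [u [v [_ _ Vu ve]]] := near0 e e0.
have ee : e ^+ 2 <= e by rewrite expr2 ler_piMr// ltW.
apply: (le_trans Vu); rewrite mulrCA ler_pM2l//; lra.
Qed.

Lemma graph_norm_complete : complete_seminorm (fun x => NK (T x) + NE (V x)).
Proof.
move=> u Hu; have [Cv Cv0 lift] := surjection_lift.
have [i|w Hw] := cK (u := fun i => T (u i)).
  by rewrite -linearB (le_trans _ (Hu i))// lerDl seminorm_ge0.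
have [i|z Hz] := cE (u := fun i => V (u i)).
  by rewrite -linearB (le_trans _ (Hu i))// lerDr seminorm_ge0.
have [e e0|y Ty Vy] := @graph_limit w z.
  (* Correcting x by b makes Vx = z exact but moves Tx by at most cT Cv times the error in Vx; hence
     tolerance e / (1 + cT Cv). *)
  have d0 : 0 < 1 + cT * Cv by rewrite ltr_wpDr// mulr_ge0.
  have ed0 : 0 < e / (1 + cT * Cv) by rewrite divr_gt0.
  have [m Hm] := Hw _ ed0; have [m' Hm'] := Hz _ ed0.
  have Tx := Hm _ (leq_maxl m m'); have Vx := Hm' _ (leq_maxr m m').
  set x := u _ in Tx Vx.
  have [b Vb Nb] := lift (V x - z).
  exists (x - b); first by rewrite linearB Vb opprB addrC subrK.
  have -> : T (x - b) - w = (T x - w) - T b by rewrite linearB addrAC.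
  apply: (le_trans (seminormB sK _ _)).
  have : NK (T b) <= cT * (Cv * (e / (1 + cT * Cv))).
    rewrite (le_trans (bT b))// ler_wpM2l// (le_trans Nb)//.
    exact: ler_wpM2l.
  have : e / (1 + cT * Cv) * (1 + cT * Cv) = e by rewrite divfK ?gt_eqF.
  by set q := e / _ in Tx *; lra.
exists y => e e0; have e20 : 0 < e / 2 by rewrite divr_gt0.
have [m Hm] := Hw _ e20; have [m' Hm'] := Hz _ e20.
exists (maxn m m') => i; rewrite geq_max => /andP[/Hm + /Hm'].
by rewrite !linearB Ty Vy; lra.
Qed.

Lemma coercive_on_cone :
  exists2 alpha, 0 < alpha & forall y, P y = 0 -> alpha * NH y ^+ 2 <= Q y.
Proof.
have [C C0 HC] := form_dominates_on_cone.
have sG : seminorm (fun x => NK (T x) + NE (V x)).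
  split=> [x y|a x].
    rewrite !linearD addrACA; apply: lerD; first exact: (seminormD sK).
    exact: (seminormD sE).
  by rewrite !linearZ (seminormZ sK) (seminormZ sE) mulrDr.
have [|M M0 HM] := @comparison _ _ NH _ (cT + cV) sH sG cH graph_norm_complete.
  by move=> x; rewrite mulrDl lerD.
(* The graph norm is definite because the kernels meet only in 0, so the vector given by
   [comparison] is x itself. *)
have bound x : NH x <= M * (NK (T x) + NE (V x)).
  have [x' [+ Nx']] := HM x.
  have := seminorm_ge0 sK (T (x - x')); have := seminorm_ge0 sE (V (x - x')).
  move=> VB0 TB0 sum0; suff xx' : x = x' by rewrite {1}xx'.
  apply/eqP; rewrite -subr_eq0; apply/eqP; apply: kerTV.
    by apply: NK_eq0; lra.
  by apply: NE_eq0; lra.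
(* |y|^2 <= M^2 (t + v)^2 <= 2 M^2 (t^2 + v^2) <= 4 M^2 C Q(y); the added 1 makes the constant
   invertible. *)
have A0 : 0 < 4 * M ^+ 2 * C + 1 by rewrite ltr_wpDl// !mulr_ge0 ?sqr_ge0// ltW.
exists (4 * M ^+ 2 * C + 1)^-1; first by rewrite invr_gt0.
move=> y Py; have [TQ VQ] := HC y Py.
have Q0 := form_ge0_on_cone Py.
rewrite mulrC ler_pdivrMr//.
set t := NK (T y) in TQ; set v := NE (V y) in VQ.
have : NH y ^+ 2 <= (M * (t + v)) ^+ 2.
  rewrite ler_pXn2r ?nnegrE ?seminorm_ge0 ?bound// mulr_ge0// addr_ge0//;
  exact: seminorm_ge0.
have : M ^+ 2 * (t + v) ^+ 2 <= M ^+ 2 * (4 * (C * Q y)).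
  by rewrite ler_wpM2l ?sqr_ge0//; have := sqr_ge0 (t - v); lra.
by rewrite exprMn; lra.
Qed.

End Coercivity.

(** * Krein spaces *)

Section NormRe.
Variable R : realType.

(** Norms over [R[i]] take values in [R[i]]; this is the same number seen in [R]. *)
Definition normRe (X : normedModType R[i]) (x : X) : R := complex.Re `|x|.

Lemma normReE (X : normedModType R[i]) (x : X) : `|x| = (normRe x)%:C.
Proof.
rewrite /normRe; have := normr_ge0 x; case: `|x| => a b.
by rewrite lecE /= => /andP[/eqP -> _].
Qed.

Lemma seminorm_normRe (X : normedModType R[i]) : seminorm (@normRe X).
Proof.
split=> [x y|a x].
  by have := ler_normD x y; rewrite !normReE -rmorphD lecR.
apply: complexI; rewrite -normReE normrZ [`|x|]normReE rmorphM.
by congr (_ * _); rewrite normc_def /= expr0n addr0 sqrtr_sqr.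
Qed.

Lemma normRe_eq0 (X : normedModType R[i]) (x : X) : normRe x = 0 -> x = 0.
Proof. by move=> x0; apply/normr0_eq0; rewrite normReE x0. Qed.

Lemma complete_normRe (X : completeNormedModType R[i]) :
  complete_seminorm (@normRe X).
Proof.
move=> u Hu; have sX := seminorm_normRe X.
have lt0C (e : R[i]) : 0 < e -> 0 < complex.Re e /\ e = (complex.Re e)%:C.
  by case: e => a b; rewrite ltcE /= => /andP[/eqP -> ?].
have cu : cvg (u @ \oo).
  apply: cauchy_cvg; apply: cauchy_exP => e /lt0C[e0 ->].
  have [m Hm] : exists m, forall i, (m <= i)%N -> 2^-1 ^+ i <= complex.Re e / 4.
    by apply: expn_half_small; rewrite divr_gt0.
  exists (u m); exists m => // n /= mn; rewrite -ball_normE /ball_ /=.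
  rewrite normReE ltcR; have := geometric_dist sX Hu mn.
  by have := Hm m (leqnn m); lra.
exists (lim (u @ \oo)) => e e0.
have eC0 : 0 < e%:C by rewrite ltcE /= eqxx.
have [m _ Hm] := cvgr_dist_le _ _ cu _ eC0; exists m => i mi.
by have := Hm i mi; rewrite /= normReE lecR seminorm_distC.
Qed.

Lemma Re_conj (z : R[i]) : complex.Re (Num.conj z) = complex.Re z.
Proof. by case: z. Qed.

Lemma Re_realM (a : R) (z : R[i]) : complex.Re (a%:C * z) = a * complex.Re z.
Proof. by case: z => b c /=; rewrite mul0r subr0. Qed.

Lemma real_form_herm (X : lmodType R[i])
    (form : {hermitian_sym X for @Num.conj R[i]}) :
  real_form (fun x y => complex.Re (form x y)).
Proof.
split=> [x y|x y z|a x y|x y].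
- by rewrite hermC expr0 mul1r Re_conj.
- by rewrite linearDl raddfD.
- by rewrite linearZl_LR Re_realM.
- rewrite linearZl_LR linearZr_LR /= mulrA (_ : 'i%C * _ = 1) ?mul1r//.
  apply/eqP; rewrite eq_complex /= !(mul0r, mul1r, mulrN, mulr1, mulr0).
  by rewrite !(opprK, oppr0, sub0r, addr0, add0r, eqxx).
Qed.

(** Polarisation: for unit vectors 4 k(x, y) = k(x + y, x + y) - k(x - y, x - y) <= 2^2 + 2^2, and
    the general case follows by scaling. *)
Lemma real_form_bound (X : lmodType R[i]) (N : X -> R) (k : X -> X -> R) :
  seminorm N -> (forall x, N x = 0 -> x = 0) -> real_form k ->
  (forall x, `|k x x| <= N x ^+ 2) ->
  forall x y, `|k x y| <= 2 * (N x * N y).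
Proof.
move=> sN N0 rk kd.
have unit x y : N x = 1 -> N y = 1 -> k x y <= 2.
  move=> Nx Ny; have := seminormD sN x y; have := seminormB sN x y.
  have := seminorm_ge0 sN (x - y); have := seminorm_ge0 sN (x + y).
  rewrite Nx Ny => p0 m0 m2 p2.
  have := le_trans (ler_norm _) (kd (x + y)).
  have := kd (x - y); rewrite ler_norml => /andP[+ _].
  rewrite (real_form_sqrB rk) (real_form_sqrD rk); nra.
have half x y : k x y <= 2 * (N x * N y).
  have [x0|x0] := eqVneq (N x) 0.
    by rewrite (N0 _ x0) -(scaler0 X 0%:C) (real_formZl rk) mul0r
       !mulr_ge0 ?seminorm_ge0.
  have [y0|y0] := eqVneq (N y) 0.
    by rewrite (N0 _ y0) -(scaler0 X 0%:C) (real_formZr rk) mul0r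
       !mulr_ge0 ?seminorm_ge0.
  have xp : 0 < N x by rewrite lt_def x0 seminorm_ge0.
  have yp : 0 < N y by rewrite lt_def y0 seminorm_ge0.
  have := unit ((N x)^-1%:C *: x) ((N y)^-1%:C *: y).
  rewrite !(seminormZ sN) !gtr0_norm ?invr_gt0// !mulVf// => /(_ erefl erefl).
  rewrite (real_formZl rk) (real_formZr rk) => le.
  rewrite -ler_pdivrMr ?mulr_gt0//.
  have -> : k x y / (N x * N y) = (N x)^-1 * ((N y)^-1 * k x y).
    by field; rewrite x0 y0.
  exact: le.
move=> x y; rewrite ler_norml half andbT.
have := half (- x) y; rewrite (real_formNl rk) (seminormN sN); lra.
Qed.

Lemma krein_form_normRe (X : completeNormedModType R[i])
    (form : {hermitian_sym X for @Num.conj R[i]}) :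
  krein_space form ->
  krein_form (@normRe X) (fun x y => complex.Re (form x y)).
Proof.
move=> [Kp [Km [[_ [Km0 Kmlin] sum ortho pos neg] nrm]]].
have rk := real_form_herm form; have sN := seminorm_normRe X.
set k := fun _ _ => _ in rk *.
have kpos u : u \in Kp -> 0 <= k u u.
  move=> up; have [->|u0] := eqVneq u 0; first by rewrite (real_form0 rk).
  by have := pos u up u0; rewrite ltcE => /andP[_] /ltW.
have kneg v : v \in Km -> k v v <= 0.
  move=> vm; have [->|v0] := eqVneq v 0; first by rewrite (real_form0 rk).
  by have := neg v vm v0; rewrite ltcE => /andP[_] /ltW.
have kort u v : u \in Kp -> v \in Km -> k u v = 0.
  by move=> up vm; rewrite /k ortho.
have N2 u v : u \in Kp -> v \in Km -> normRe (u + v) ^+ 2 = k u u - k v v.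
  move=> up vm; have := congr1 (@complex.Re R) (nrm u v up vm).
  by rewrite normReE -rmorphXn /= raddfB.
have KmN v : v \in Km -> - v \in Km.
  by move=> vm; rewrite -scaleN1r -[_ *: _]addr0 Kmlin.
split=> // [|x].
  apply: (real_form_bound sN (@normRe_eq0 X) rk) => x.
  have [u [v [up vm ->]]] := sum x.
  rewrite N2// (real_form_sqrD rk) (kort u v)// ler_norml.
  by have := kpos u up; have := kneg v vm; lra.
(* u - v is the image of u + v under the fundamental symmetry of the decomposition. *)
have [u [v [up vm ->]]] := sum x; exists (u - v); split.
  rewrite N2// (real_formDl rk) !(real_formDr rk) !(real_formNr rk).
  by rewrite (real_formC rk v) (kort u v)//; lra.
apply/eqP; rewrite -(@eqrXn2 _ 2) ?seminorm_ge0// N2 ?KmN// N2//.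
by rewrite (real_formNl rk) (real_formNr rk) opprK.
Qed.

End NormRe.

Lemma bounded_normRe (R : realType) (X Y : normedModType R[i]) (f : X -> Y) :
  bounded_operator f ->
  exists2 c, 0 <= c & forall x, normRe (f x) <= c * normRe x.
Proof.
move=> [M HM]; exists `|M| => // x.
have := HM x; rewrite !normReE -rmorphM lecR => /le_trans; apply.
by rewrite ler_wpM2r ?ler_norm// seminorm_ge0//; exact: seminorm_normRe.
Qed.

(** * Passage from complex-valued forms and indefinite operators to the real setting *)

Lemma form_real (R : realType) (X : lmodType R[i])
    (form : {hermitian_sym X for @Num.conj R[i]}) (x : X) :
  form x x = (complex.Re (form x x))%:C.
Proof.
have : form x x = Num.conj (form x x) by rewrite {1}hermC expr0 mul1r.
case: (form x x) => a b [] /= bb; congr (_ +i* _); lra.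
Qed.

(** Selfadjointness and the adjoint relation give [ip (Tadj (T x)) x = form (T x) (T x)], so each
    failure of semidefiniteness produces a vector of the opposite sign. *)
Lemma indefinite_sign (R : realType) (H K : lmodType R[i])
    (ip : {dot H for @Num.conj R[i]})
    (form : {hermitian_sym K for @Num.conj R[i]})
    (T : H -> K) (Tadj : K -> H) :
  adjoint_of ip form T Tadj -> indefinite ip (Tadj \o T) ->
  (exists x, 0 < complex.Re (form (T x) (T x))) /\
  (exists x, complex.Re (form (T x) (T x)) < 0).
Proof.
move=> adj [sa npos nneg].
have E x : ip (Tadj (T x)) x = (complex.Re (form (T x) (T x)))%:C.
  by have := sa x x; rewrite /= -adj => ->; exact: form_real.
split; apply: contrapT => none; [apply: nneg|apply: npos] => x /=; rewrite E.
  by rewrite (lecR _ 0) leNgt; apply/negP => xp; apply: none; exists x.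
by rewrite (lecR 0) leNgt; apply/negP => xp; apply: none; exists x.
Qed.

Theorem proposition4p3 (R : realType) (H K E : completeNormedModType R[i])
    (ip : {dot H for @Num.conj R[i]})
    (formK : {hermitian_sym K for @Num.conj R[i]})
    (formE : {hermitian_sym E for @Num.conj R[i]})
    (T : {linear H -> K}) (V : {linear H -> E})
    (Tadj : K -> H) (Vadj : E -> H)
    (hilbertH : hilbert_space ip) (separableH : separable H)
    (kreinK : krein_space formK) (kreinE : krein_space formE)
    (boundedT : bounded_operator T) (closedT : closed (range T))
    (boundedV : bounded_operator V) (surjV : range V = setT)
    (adjT : adjoint_of ip formK T Tadj) (adjV : adjoint_of ip formE V Vadj)
    (indefT : indefinite ip (Tadj \o T)) (indefV : indefinite ip (Vadj \o V))
    (kerTV : nullspace T `&` nullspace V = [set 0])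
    (solvable : forall (w : K) (z : E), minimizers formK formE T V w z !=set0) :
  exists2 alpha : R, 0 < alpha &
    forall y : H, neutral formE V y ->
      alpha%:C * `|y| ^+ 2 <= formK (T y) (T y).
Proof.
have [cT cT0 bT] := bounded_normRe boundedT.
have [cV cV0 bV] := bounded_normRe boundedV.
have [_ Tneg] := indefinite_sign adjT indefT.
have [Vpos Vneg] := indefinite_sign adjV indefV.
(* [formE z z] is real, so neutrality and feasibility can be read on real parts. *)
have neutralE z : formE z z = 0 <-> complex.Re (formE z z) = 0.
  by split=> [->//|]; rewrite [formE z z]form_real => ->.
have [|x Tx Vx|w z|alpha alpha0 Halpha] := coercive_on_cone
    (seminorm_normRe H) (seminorm_normRe K) (seminorm_normRe E)
    (@complete_normRe _ H) (@complete_normRe _ K) (@complete_normRe _ E)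
    (@normRe_eq0 _ K) (@normRe_eq0 _ E)
    (krein_form_normRe kreinK) (krein_form_normRe kreinE)
    cT0 cV0 bT bV _ Tneg Vpos Vneg.
- move=> z; have [x _ <-] : range V z by rewrite surjV.
  by exists x.
- suff: [set 0] x by [].
  by rewrite -kerTV.
- have [x [/neutralE Vx xmin]] := solvable w z; exists x => // x' /neutralE Vx'.
  by have := xmin x' Vx'; rewrite lecE => /andP[].
exists alpha => // y /neutralE Py.
rewrite [formK _ _]form_real normReE -rmorphXn -rmorphM lecR.
exact: Halpha.
Qed.
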